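(* Let $g_1,\dots,g_N$ ($N\ge 1$) be linear polynomials over $\mathbb{Q}$ in the variables $x_1,\dots,x_n$, each depending on at least $\frac{n}{2}$ variables (i.e. having at least $n/2$ variables with nonzero coefficient), such that the linear clause $\bigvee_{j\in[N]} g_j=0$ is a tautology (true under every 0-1 assignment). Then every tree-like $\mathrm{Res}(\mathrm{lin}_{\mathbb{Q}})$ derivation of $\bigvee_{j\in[N]} g_j=0$ (from the boolean axioms alone) has size $2^{\Omega(\sqrt{n})}$.
   Context: A linear clause over a ring $R$ is a disjunction $(f_1=0)\vee\dots\vee(f_k=0)$ of linear equations with linear forms over $R$ (duplicate disjuncts identified); variables range over $\{0,1\}$. The proof system $\mathrm{Res}(\mathrm{lin}_R)$ has the boolean axioms $x=0\vee x=1$ for every variable $x$ and the rules: resolution (from $C\vee f=0$ and $D\vee g=0$ derive $C\vee D\vee(\alpha f+\beta g=0)$, $\alpha,\beta\in R$), simplification (from $C\vee a=0$ with $a\in R\setminus\{0\}$ a constant derive $C$), weakening (from $C$ derive $C\vee f=0$). A derivation of $D$ is a sequence of linear clauses ending in $D$, each a boolean axiom or obtained from earlier clauses by a rule; it is tree-like if every occurrence of a clause is used at most once as a premise. Size is the total number of variable occurrences plus the total bit-size of coefficients. *)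

(* Defs.v *)
From mathcomp Require Import all_boot all_order all_algebra finmap.

Set Implicit Arguments.
Unset Strict Implicit.
Unset Printing Implicit Defensive.

Import GRing.Theory.
Local Open Scope ring_scope.

(* [(a, b)] stands for a_0 x_0 + ... + a_(m-1) x_(m-1) + b. *)
Notation linpoly K m := ('rV[K]_m * K^o)%type.

Definition lvars (K : nzRingType) (m : nat) (f : linpoly K m) : {set 'I_m} :=
  [set i | f.1 0 i != 0].

Definition leval (K : nzRingType) (m : nat) (f : linpoly K m)
    (a : 'I_m -> bool) : K :=
  \sum_(i < m) f.1 0 i * (a i)%:R + f.2.

Definition lvar (K : nzRingType) (m : nat) (i : 'I_m) : linpoly K m :=
  (delta_mx 0 i, 0).

Definition lconst (K : nzRingType) (m : nat) (c : K) : linpoly K m := (0, c).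

(* The same polynomial, seen in k additional variables. *)
Definition lwiden (K : nzRingType) (n k : nat) (f : linpoly K n) :
    linpoly K (n + k) :=
  (row_mx f.1 0, f.2).

(* The disjunction of the equations f = 0 for f in the set. *)
Definition clause (K : nzRingType) (m : nat) : Type := {fset linpoly K m}.

Definition tautology (K : nzRingType) (m : nat) (C : clause K m) : Prop :=
  forall a : 'I_m -> bool, exists2 f, f \in C & leval f a = 0.

(* [rule Ps C]: C follows from the list of premises Ps by one rule. *)
Inductive rule (K : nzRingType) (m : nat) :
    seq (clause K m) -> clause K m -> Prop :=
| BooleanAxiom (i : 'I_m) :
    rule [::] [fset lvar K i; (lvar K i - lconst m 1)%R]%fset
| Resolution (C D : clause K m) (f g : linpoly K m) (a b : K) :
    rule [:: f |` C; g |` D]%fset ((a *: f + b *: g)%R |` (C `|` D))%fset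
| Simplification (C : clause K m) (c : K) :
    c != 0 -> rule [:: lconst m c |` C]%fset C
| Weakening (C : clause K m) (f : linpoly K m) :
    rule [:: C] (f |` C)%fset.

(* A line is a clause with the positions of the premises it is derived from. *)
Definition reslin_proof (K : nzRingType) (m : nat) : Type :=
  seq (clause K m * seq nat).

Definition clause_at (K : nzRingType) (m : nat) (pi : reslin_proof K m)
    (l : nat) : clause K m :=
  (nth (fset0, [::]) pi l).1.

Definition premises_at (K : nzRingType) (m : nat) (pi : reslin_proof K m)
    (l : nat) : seq nat :=
  (nth (fset0, [::]) pi l).2.

Definition derivation (K : nzRingType) (m : nat) (pi : reslin_proof K m)
    (D : clause K m) : Prop :=
  [/\ (0 < size pi)%N,
      clause_at pi (size pi).-1 = D
    & forall l, (l < size pi)%N ->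
        all (fun p => p < l)%N (premises_at pi l) /\
        rule [seq clause_at pi p | p <- premises_at pi l] (clause_at pi l)].

(* No position occurs twice as a premise in the whole proof, in particular not
   twice in the same resolution step. *)
Definition tree_like (K : nzRingType) (m : nat) (pi : reslin_proof K m) :
    bool :=
  uniq (flatten [seq l.2 | l <- pi]).

(* Number of binary digits, with one digit for 0. *)
Definition nat_bits (k : nat) : nat := (trunc_log 2 k).+1.

Definition rat_bits (q : rat) : nat :=
  (nat_bits `|numq q| + nat_bits `|denq q|)%N.

(* Polynomials are written sparsely: zero coefficients of variables cost
   nothing, the constant term is always written. *)
Definition linpoly_size (m : nat) (f : linpoly rat m) : nat :=
  (#|lvars f| + \sum_(i in lvars f) rat_bits (f.1 0%R i) + rat_bits f.2)%N.

Definition clause_size (m : nat) (C : clause rat m) : nat :=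
  (\sum_(f <- C) linpoly_size f)%N.

Definition proof_size (m : nat) (pi : reslin_proof rat m) : nat :=
  (\sum_(l <- pi) clause_size l.1)%N.

(* Main.v *)
Require Import Defs.
From mathcomp Require Import all_boot all_order all_algebra finmap.
From mathcomp Require Import reals exp.
From mathcomp Require Import zify.

(** The proof tree is read from its root as a Prover-Delayer game on the negated
    clauses [h <> 0]. The Delayer keeps a satisfiable set [S] of disequalities
    such that on the 0-1 points satisfying [S] every polynomial of the current
    clause either has no zero or is a nonzero multiple of some [g_j]. At a
    resolution step on [f] and [g] one of the two branches is free when [f] or
    [g] vanishes on those points; otherwise both branches survive with one more
    disequality in [S]. An axiom [x = 0 \/ x = 1] can only be reached once
    some [x - a g_j] or [x - 1 - a g_j] vanishes at all points satisfying [S],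
    and this forces [S] to be large: fix such a point and take the variables
    whose flip increases that polynomial, or those whose flip decreases it,
    whichever are more. The product of [S] vanishes on all nontrivial flips of
    these variables but not at the point itself, so its degree is at least
    their number. *)

Set Implicit Arguments.
Unset Strict Implicit.
Unset Printing Implicit Defensive.

Import Order.TTheory GRing.Theory Num.Theory.
Local Open Scope ring_scope.

(** * Alternating sums over a subcube *)

Lemma sum_subset_setU1 (V : nmodType) (T : finType) (I : {set T}) (i : T)
    (F : {set T} -> V) : i \in I ->
  \sum_(A : {set T} | (A \subset I) && (i \in A)) F A =
  \sum_(A : {set T} | A \subset I :\ i) F (i |: A).
Proof.
move=> iI; rewrite (reindex_onto (fun A => i |: A) (fun A => A :\ i)) /=.
  apply: eq_bigl => A; rewrite subUset sub1set iI setU11 andbT /=.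
  rewrite subsetD1; congr (_ && _); apply/eqP/idP => [<-|iA].
    by rewrite !inE eqxx.
  by rewrite setU1K.
by move=> A /andP[_ iA]; rewrite setD1K.
Qed.

(** The product has degree below [#|I|] in the indicators of [A], so each of its monomials misses
    some [i] in [I], and the terms of [A] and [i |: A] cancel. *)
Lemma alternating_sum_prod_affine (K : comNzRingType) (T : finType)
    (ls : seq (K * (T -> K))) (I : {set T}) :
  (size ls < #|I|)%N ->
  \sum_(A : {set T} | A \subset I)
    (-1) ^+ #|A| * \prod_(l <- ls) (l.1 + \sum_(i in A) l.2 i) = 0.
Proof.
have [k] := ubnP (size ls); elim: k ls I => // k IHk ls I.
case: ls => [_|l ls] /=.
  rewrite card_gt0 => /set0Pn[i iI].
  under eq_bigr do rewrite big_nil mulr1.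
  rewrite (bigID (fun A : {set T} => i \in A)) /= sum_subset_setU1 //.
  under [X in _ + X]eq_bigl do rewrite -subsetD1.
  rewrite -big_split big1 //= => A; rewrite subsetD1 => /andP[_ iA].
  by rewrite cardsU1 iA exprS mulN1r addNr.
rewrite ltnS => lsk lsI.
under eq_bigr do rewrite big_cons mulrCA mulrDl.
rewrite big_split -big_distrr /= IHk ?mulr0 ?add0r //; last exact: ltnW.
under eq_bigr do rewrite mulr_suml.
rewrite (exchange_big_dep (mem I)) /=; last by move=> A i /subsetP; apply.
apply: big1 => i iI; rewrite sum_subset_setU1 //.
(* Every set left contains [i]: its contribution moves into the constants of the other factors, so
   one factor and one element of [I] drop together. *)
pose ls' := [seq (m.1 + m.2 i, m.2) | m <- ls].
have := IHk ls' (I :\ i); rewrite size_map => /(_ lsk).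
rewrite -ltnS (leq_trans lsI) ?(cardsD1 i I) ?iI //= => /(_ isT).
move=> /(congr1 ( *%R (- l.2 i))); rewrite mulr0 big_distrr /=.
apply: etrans; apply: eq_bigr => A; rewrite subsetD1 => /andP[_ iA].
rewrite cardsU1 iA exprS mulN1r !mulNr mulrN /ls' big_map.
congr (- (_ * (_ * _))); apply: eq_bigr => m _ /=.
by rewrite big_setU1 //= addrA.
Qed.

(** * Evaluation of linear polynomials and bit flips *)

Lemma leval_lin (K : comNzRingType) m (f g : linpoly K m) (a b : K) x :
  leval (a *: f + b *: g) x = a * leval f x + b * leval g x.
Proof.
rewrite /leval /= !mulrDr addrACA; congr (_ + _).
rewrite !mulr_sumr -big_split; apply: eq_bigr => i _ /=.
by rewrite !mxE mulrDl !mulrA.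
Qed.

Lemma leval_lconst (K : nzRingType) m (c : K) x : leval (@lconst K m c) x = c.
Proof.
by rewrite /leval big1 ?add0r // => i _; rewrite mxE mul0r.
Qed.

Definition flip m (x : {ffun 'I_m -> bool}) (A : {set 'I_m}) :=
  [ffun i => x i (+) (i \in A)].

Lemma leval_flip (K : comNzRingType) m (f : linpoly K m) x A :
  leval f (flip x A) = leval f x + \sum_(i in A) f.1 0 i * (-1) ^+ x i.
Proof.
rewrite /leval addrAC; congr (_ + _); rewrite [X in _ + X]big_mkcond -big_split.
apply: eq_bigr => i _ /=; rewrite ffunE; case: (i \in A); last first.
  by rewrite addbF addr0.
by rewrite -mulrDr; case: (x i); rewrite ?addrN ?addr0 ?add0r.
Qed.

Definition nonzeros (K : nzRingType) m (S : seq (linpoly K m)) :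
    {set {ffun 'I_m -> bool}} :=
  [set x : {ffun 'I_m -> bool} | all (fun f : linpoly K m => leval f x != 0) S].

(** * Polynomials vanishing wherever all disequalities hold *)

Section Cover.
Variables (K : realFieldType) (m : nat) (S : seq (linpoly K m)).
Variable x : {ffun 'I_m -> bool}.
Hypothesis Sx : x \in nonzeros S.

(* The product of S would be a multilinear polynomial of degree less than |I|
   which on the cube of the flips of x in I is nonzero at x only. *)
Lemma card_positive_flips (h : linpoly K m) :
  {in nonzeros S, forall y : {ffun 'I_m -> bool}, leval h y = 0} ->
  (#|[set i | (0 < h.1 0%R i * (-1) ^+ x i)%R]| <= size S)%N.
Proof.
move=> h0; set I := [set i | _]; rewrite leqNgt; apply/negP => ltSI.
pose ls := [seq (leval f x, fun i => f.1 0 i * (-1) ^+ x i) | f <- S].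
have := @alternating_sum_prod_affine _ _ ls I.
rewrite size_map => /(_ ltSI) /eqP; apply/negP.
under eq_bigr => A do [rewrite big_map /=;
  under [X in _ * X]eq_bigr do rewrite -leval_flip].
rewrite (bigD1 set0) ?sub0set //= [X in _ + X]big1 ?addr0.
  rewrite cards0 mul1r prodf_seq_neq0; move: Sx; rewrite inE.
  apply: sub_all => f; rewrite leval_flip big_set0 addr0 /=.
  by [].
move=> A /andP[AI /set0Pn[i iA]].
(* Each flip in [A] raises [h] from its value 0 at [x], so the flipped point violates [S] and some
   factor vanishes there. *)
have hA : leval h (flip x A) != 0.
  rewrite leval_flip h0 // add0r gt_eqF // (bigD1 i) //=.
  have pos j : j \in A -> 0 < h.1 0 j * (-1) ^+ x j.
    by move=> /(subsetP AI); rewrite inE.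
  rewrite ltr_pwDl ?pos // sumr_ge0 // => j /andP[jA _]; exact/ltW/pos.
have : flip x A \notin nonzeros S by apply: contra hA => /h0 ->.
rewrite inE -has_predC => /hasP[f fS /= /negPn/eqP f0].
by rewrite (big_rem f) //= f0 mul0r mulr0.
Qed.

(** Flipping a variable of [h] raises either [h] or [- h], and the bound on positive flips applies
    to both. *)
Lemma card_lvars_vanishing (h : linpoly K m) :
  {in nonzeros S, forall y : {ffun 'I_m -> bool}, leval h y = 0} ->
  (#|lvars h| <= (size S).*2)%N.
Proof.
move=> h0; have := card_positive_flips h0.
have Nh0 : {in nonzeros S, forall y : {ffun 'I_m -> bool},
    leval ((-1) *: h + 0 *: h) y = 0}.
  by move=> y /h0 hy; rewrite leval_lin hy !mulr0 addr0.
have := card_positive_flips Nh0; rewrite -addnn => le1 le2.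
apply: leq_trans (leq_add le2 le1); apply: leq_trans (leq_card_setU _ _).
apply/subset_leq_card/subsetP => i; rewrite !inE !mxE mulN1r mul0r addr0 mulNr.
by move=> hi; rewrite oppr_gt0 -neq_lt eq_sym mulf_neq0 ?signr_eq0.
Qed.

End Cover.

(** * Weights of unfolded proof trees *)

Section TreeWeight.
Variables (prem : nat -> seq nat) (v : nat -> nat).
Hypothesis prem_lt : forall l, all (fun p => p < l)%N (prem l).

Fixpoint fuel_weight k l :=
  (v l + if k is k'.+1 then \sum_(p <- prem l) fuel_weight k' p else 0)%N.

(** Premises have smaller positions, so fuel [l] already reaches every leaf below [l]. *)
Lemma fuel_weight_stable j k l :
  (l <= j)%N -> (l <= k)%N -> fuel_weight j l = fuel_weight k l.
Proof.
have prem0 : prem 0 = [::] by case: (prem 0) (prem_lt 0).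
elim: j k l => [|j IHj] [|k] l /=.
- by [].
- by rewrite leqn0 => /eqP->; rewrite prem0 big_nil.
- by move=> _; rewrite leqn0 => /eqP->; rewrite prem0 big_nil.
move=> lj lk; congr addn; apply: eq_big_seq => p /(allP (prem_lt l)) pl.
by apply: IHj; rewrite -ltnS (leq_trans pl).
Qed.

Definition tree_weight l := fuel_weight l l.

Lemma tree_weightE l :
  tree_weight l = (v l + \sum_(p <- prem l) tree_weight p)%N.
Proof.
rewrite {1}/tree_weight (@fuel_weight_stable l l.+1) //=; congr addn.
apply: eq_big_seq => p /(allP (prem_lt l)) /ltnW pl.
by apply: fuel_weight_stable.
Qed.

(* Sum [tree_weightE] over all l < s: every weight but the last one reappears
   at most once on the right. *)
Lemma tree_weight_last s :
  (0 < s)%N -> uniq (flatten [seq prem l | l <- iota 0 s]) ->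
  (tree_weight s.-1 <= \sum_(0 <= l < s) v l)%N.
Proof.
case: s => // s _ /= Uprem.
have : (\sum_(p <- flatten [seq prem l | l <- iota 0 s.+1]) tree_weight p <=
        \sum_(0 <= p < s) tree_weight p)%N.
  rewrite /index_iota subn0.
  apply: (uniq_sub_le_big leqnn (fun x y => leq_addr y x)) => //.
    exact: iota_uniq.
  move=> p /flatten_mapP[l]; rewrite !mem_iota !add0n ltnS => ls.
  by move=> /(allP (prem_lt l)) pl; apply: leq_trans ls.
rewrite big_flatten big_map -(leq_add2l (\sum_(0 <= l < s.+1) v l)).
rewrite -{1}[iota 0 s.+1]/(index_iota 0 s.+1) -big_split /=.
under eq_bigr do rewrite -tree_weightE.
by rewrite big_nat_recr //= addnC leq_add2r.
Qed.

End TreeWeight.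

(** * The Delayer's strategy *)

Section Delayer.
Variables (K : realFieldType) (m : nat) (D : clause K m) (t : nat).
Hypothesis many_vars : forall g, g \in D -> (t <= #|lvars g|)%N.

(** The factor [a] absorbs the coefficients of resolution steps. *)
Definition decided (S : seq (linpoly K m)) (h : linpoly K m) : Prop :=
  {in nonzeros S, forall x : {ffun 'I_m -> bool}, leval h x != 0} \/
  exists g a, [/\ g \in D, a != 0
    & {in nonzeros S, forall x : {ffun 'I_m -> bool},
         leval h x = a * leval g x}].

Lemma sub_decided (S S' : seq (linpoly K m)) h :
  nonzeros S' \subset nonzeros S -> decided S h -> decided S' h.
Proof.
move=> /subsetP sub [hS|[g [a [gD a0 hS]]]]; first by left=> x /sub /hS.
by right; exists g, a; split=> // x /sub /hS.
Qed.

Lemma nonzeros_cons (S : seq (linpoly K m)) f :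
  nonzeros (f :: S) \subset nonzeros S.
Proof. by apply/subsetP => x; rewrite !inE /= => /andP[]. Qed.

Lemma nonzeros_cons_eq0 (S : seq (linpoly K m)) f :
  nonzeros (f :: S) = set0 ->
  {in nonzeros S, forall x : {ffun 'I_m -> bool}, leval f x = 0}.
Proof.
move=> S0 x; rewrite inE => Sx; apply/eqP; apply: contraTT isT => fx.
by have := in_set0 x; rewrite -S0 inE /= fx Sx.
Qed.

Lemma decided_const S c : c != 0 -> decided S (lconst m c).
Proof. by move=> c0; left=> x _; rewrite leval_lconst. Qed.

Section State.
Variable S : seq (linpoly K m).
Hypothesis S_sat : nonzeros S != set0.
Hypothesis S_small : (size S < t./2)%N.

(** The spare unit pays for the one variable of an axiom literal. *)
Lemma vanishing_lvars_small (h : linpoly K m) :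
  {in nonzeros S, forall x : {ffun 'I_m -> bool}, leval h x = 0} ->
  (#|lvars h|.+1 < t)%N.
Proof.
by case/set0Pn: S_sat => x Sx /(card_lvars_vanishing Sx); lia.
Qed.

(** On the points of [S] the resolvent equals [b * g], so [g] inherits its status up to a scalar. If
    [b = 0] it vanishes there, which contradicts its being nonzero or makes a polynomial of [D],
    with its many variables, vanish too. *)
Lemma decided_resolvent f g a b :
  {in nonzeros S, forall x : {ffun 'I_m -> bool}, leval f x = 0} ->
  decided S (a *: f + b *: g) -> decided S g.
Proof.
move=> f0; have [->|b0] := eqVneq b 0.
  have h0 : {in nonzeros S, forall x : {ffun 'I_m -> bool},
      leval (a *: f + 0 *: g) x = 0}.
    by move=> x /f0 fx; rewrite leval_lin fx mulr0 mul0r addr0.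
  case=> [hS|[g' [c [g'D c0 hS]]]].
    by case/set0Pn: S_sat => x Sx; have := hS x Sx; rewrite h0 // eqxx.
  suff /vanishing_lvars_small : {in nonzeros S,
      forall x : {ffun 'I_m -> bool}, leval g' x = 0}.
    by have := many_vars g'D; lia.
  by move=> x Sx; apply/eqP; have := hS x Sx; rewrite h0 // => /esym/eqP;
    rewrite mulf_eq0 (negPf c0).
have gE : {in nonzeros S, forall x : {ffun 'I_m -> bool},
    leval (a *: f + b *: g) x = b * leval g x}.
  by move=> x /f0 fx; rewrite leval_lin fx mulr0 add0r.
case=> [hS|[g' [c [g'D c0 hS]]]].
  by left=> x Sx; have := hS x Sx; rewrite gE // mulf_eq0 negb_or => /andP[].
right; exists g', (b^-1 * c); split=> //; first by rewrite mulf_neq0 ?invr_eq0.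
by move=> x Sx; rewrite -mulrA -hS // gE // mulKf.
Qed.

(** Otherwise [h - a g] vanishes on the points of [S] but keeps all but at most one variable of [g],
    too many for a small [S]. *)
Lemma decided_literal (h : linpoly K m) :
  (#|lvars h| <= 1)%N -> decided S h ->
  {in nonzeros S, forall x : {ffun 'I_m -> bool}, leval h x != 0}.
Proof.
move=> h1 [//|[g [a [gD a0 hS]]]].
have /vanishing_lvars_small : {in nonzeros S,
    forall x : {ffun 'I_m -> bool}, leval (1 *: h + (- a) *: g) x = 0}.
  by move=> x Sx; rewrite leval_lin hS // mul1r mulNr addrN.
suff : (#|lvars g| <= #|lvars h| + #|lvars (1 *: h + (- a) *: g)%R|)%N.
  by have := many_vars gD; lia.
apply: leq_trans (leq_card_setU _ _); apply/subset_leq_card/subsetP => j.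
rewrite !inE !mxE mul1r mulNr; case: (eqVneq (h.1 0 j) 0) => //= ->.
by rewrite add0r oppr_eq0 mulf_eq0 (negPf a0).
Qed.

(** Any point satisfying [S] is a zero of one of the two literals. *)
Lemma axiom_undecided i :
  decided S (lvar K i) -> ~ decided S (lvar K i - lconst m 1).
Proof.
have lvars1 (h : linpoly K m) : h.1 = delta_mx 0 i -> (#|lvars h| <= 1)%N.
  move=> hE; rewrite -(cards1 i); apply/subset_leq_card/subsetP => j.
  by rewrite !inE hE mxE eqxx /=; case: (j == i); rewrite ?eqxx.
have [x0 x1] : (lvar K i).1 = delta_mx 0 i /\
    (lvar K i - lconst m 1).1 = delta_mx 0 i by rewrite /= subr0.
case/set0Pn: S_sat => x Sx.
move=> /(decided_literal (lvars1 _ x0))/(_ x Sx) +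
  /(decided_literal (lvars1 _ x1))/(_ x Sx).
have lvarE : leval (lvar K i) x = (x i)%:R.
  rewrite /leval addr0 (bigD1 i) //= mxE !eqxx mul1r big1 ?addr0 // => j ji.
  by rewrite mxE (negPf ji) andbF mul0r.
have -> : lvar K i - lconst m 1 = 1 *: lvar K i + (-1) *: lconst m 1.
  by rewrite scale1r scaleN1r.
rewrite leval_lin leval_lconst lvarE.
by case: (x i); rewrite !mul1r ?mulN1r ?subrr eqxx.
Qed.

End State.

Variable v : clause K m -> nat.
Hypothesis v_axiom :
  forall i, (0 < v [fset lvar K i; (lvar K i - lconst m 1)%R]%fset)%N.
Variable pi : reslin_proof K m.
Hypothesis pi_D : derivation pi D.

Let w := tree_weight (premises_at pi) (fun l => v (clause_at pi l)).

Lemma premises_lt l : all (fun p => p < l)%N (premises_at pi l).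
Proof.
have [_ _ pi_ok] := pi_D; have [/pi_ok[]//|le] := ltnP l (size pi).
by rewrite /premises_at nth_default.
Qed.

Let wE l : w l = (v (clause_at pi l) + \sum_(p <- premises_at pi l) w p)%N.
Proof. exact/tree_weightE/premises_lt. Qed.

(** Following first premises ends at an axiom, where [v] is positive. *)
Lemma tree_weight_gt0 l : (l < size pi)%N -> (0 < w l)%N.
Proof.
elim/ltn_ind: l => l IHl ls; rewrite wE addn_gt0.
have [_ _ /(_ l ls)[+ r]] := pi_D.
case premE: (premises_at pi l) r => [|p ps] r /= => [_|/andP[pl _]].
  suff -> : (0 < v (clause_at pi l))%N by [].
  by inversion r.
by rewrite big_cons addn_gt0 (IHl p) ?orbT // (ltn_trans pl).
Qed.

Lemma tree_weight_lb l S :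
  (l < size pi)%N -> nonzeros S != set0 ->
  (forall h, h \in clause_at pi l -> decided S h) ->
  (2 ^ (t./2 - size S) <= w l)%N.
Proof.
elim/ltn_ind: l S => l IHl S ls S_sat S_C.
have [S_big|S_small] := leqP (t./2) (size S).
  (* The budget of disequalities is spent: truncated subtraction makes the bound 1. *)
  by rewrite (eqP S_big) tree_weight_gt0.
have [_ _ /(_ l ls)[+ r]] := pi_D.
have := wE l; case: (premises_at pi l) r => [|p [|q [|? ?]]] /= r wl;
  rewrite ?andbT => lt_l.
- inversion r as [i EP E| | |]; case: (@axiom_undecided S S_sat S_small i);
    by apply: S_C; rewrite -E !inE eqxx ?orbT.
- rewrite wl big_seq1; apply: leq_trans (leq_addl _ _).
  apply: IHl => // [|h]; first exact: ltn_trans ls.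
  inversion r as [| |C c c0 EP EC|C f EP EC].
    rewrite !inE => /orP[/eqP->|]; first exact: decided_const.
    exact: S_C.
  by move=> hC; apply: S_C; rewrite -EC !inE hC orbT.
- case/andP: lt_l => pl ql; rewrite wl big_cons big_seq1.
  apply: leq_trans (leq_addl _ _).
  inversion r as [|C E f g a b [EP EQ] EC| |].
  have sub S' h : nonzeros S' \subset nonzeros S ->
      (h \in C) || (h \in E) -> decided S' h.
    move=> /sub_decided sub hCE; apply/sub/S_C.
    by rewrite -EC !inE; case/orP: hCE => ->; rewrite !orbT.
  have fg_S : decided S (a *: f + b *: g) by apply: S_C; rewrite -EC !inE eqxx.
  have [/nonzeros_cons_eq0 f0|f_sat] := eqVneq (nonzeros (f :: S)) set0.
    apply: leq_trans (leq_addl _ _); apply: IHl => // [|h].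
      exact: ltn_trans ls.
    rewrite -EQ !inE => /orP[/eqP->|hE]; last by apply: sub; rewrite ?hE ?orbT.
    exact: decided_resolvent f0 fg_S.
  have [/nonzeros_cons_eq0 g0|g_sat] := eqVneq (nonzeros (g :: S)) set0.
    apply: leq_trans (leq_addr _ _); apply: IHl => // [|h].
      exact: ltn_trans ls.
    rewrite -EP !inE => /orP[/eqP->|hC]; last by apply: sub; rewrite ?hC.
    by move: fg_S; rewrite addrC; apply: decided_resolvent.
  have decided_new e : decided (e :: S) e.
    by left=> x; rewrite inE => /andP[].
  (* Both branches are satisfiable: each spends one disequality and yields half of the bound. *)
  have := subnSK S_small => <-; rewrite expnS mul2n -addnn.
  apply: leq_add.
    apply: (IHl p pl (f :: S)) => // [|h]; first exact: ltn_trans ls.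
    rewrite -EP !inE => /orP[/eqP->//|hC].
    by apply: sub; rewrite ?nonzeros_cons ?hC.
  apply: (IHl q ql (g :: S)) => // [|h]; first exact: ltn_trans ls.
  rewrite -EQ !inE => /orP[/eqP->//|hE].
  by apply: sub; rewrite ?nonzeros_cons ?hE ?orbT.
- by inversion r.
Qed.

(** The game starts at the last line with empty [S], each polynomial of [D] being its own multiple
    by 1. *)
Lemma tree_like_weight_lb :
  tree_like pi -> (2 ^ t./2 <= \sum_(l <- pi) v l.1)%N.
Proof.
have [pi_gt0 pi_last _] := pi_D; rewrite /tree_like => Upi.
rewrite (big_nth (fset0, [::])).
apply: leq_trans (tree_weight_last _ premises_lt pi_gt0 _); last first.
  rewrite (_ : map _ _ = [seq l.2 | l <- pi]) //.
  by rewrite -[in RHS](mkseq_nth (fset0, [::]) pi) -map_comp.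
rewrite -[(t./2)%N]subn0; apply: (@tree_weight_lb _ [::]).
- by rewrite prednK.
- by apply/set0Pn; exists [ffun=> false]; rewrite inE.
move=> h; rewrite pi_last => hD; right; exists h, 1.
by split; rewrite ?oner_eq0 // => x _; rewrite mul1r.
Qed.

End Delayer.

(** * The size bound *)

Lemma card_lvars_lwiden (K : nzRingType) n k (f : linpoly K n) :
  #|lvars (lwiden k f)| = #|lvars f|.
Proof.
rewrite -(card_imset _ (@lshift_inj n k)); apply: eq_card => i.
rewrite inE /= mxE; case: splitP => j ij; last first.
  rewrite mxE eqxx; apply/esym/imsetP => -[i' _ ii'].
  by have := ltn_ord i'; move: ij; rewrite ii' /=; lia.
have -> : i = lshift k j by apply: val_inj.
by rewrite mem_imset ?inE //; apply: lshift_inj.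
Qed.

Theorem mainTheorem3 (R : realType) :
  exists2 c : R, 0 < c &
  exists n0 : nat,
  forall (n N : nat) (g : 'I_N -> linpoly rat n),
    (n0 <= n)%N ->
    (0 < N)%N ->
    (forall j, n%:R / 2 <= #|lvars (g j)|%:R :> rat) ->
    tautology [fset g j | j in 'I_N]%fset ->
    forall (k : nat) (pi : reslin_proof rat (n + k)),
      derivation pi [fset lwiden k (g j) | j in 'I_N]%fset ->
      tree_like pi ->
      2 `^ (c * Num.sqrt n%:R) <= (proof_size pi)%:R.
Proof.
(* Halving [uphalf n] leaves at least [n / 8] once [n >= 4], and [n] is at least its square root. *)
exists 8^-1; first by rewrite invr_gt0 ltr0n.
exists 4%N => n N g n4 _ g_vars _ k pi pi_D pi_tree.
have D_vars h : h \in [fset lwiden k (g j) | j in 'I_N]%fset ->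
    (uphalf n <= #|lvars h|)%N.
  case/imfsetP => j _ ->; rewrite card_lvars_lwiden.
  have := g_vars j; rewrite ler_pdivrMr // -natrM ler_nat; lia.
(* The constant term always costs a digit, even when it is 0. *)
have axiom_size i : (0 < clause_size
    [fset lvar rat i; (lvar rat i - lconst (n + k) 1)%R]%fset)%N.
  rewrite /clause_size (big_rem (lvar rat i)) ?fset21 //=.
  by rewrite /linpoly_size /rat_bits /nat_bits !addn_gt0 !orbT.
have := tree_like_weight_lb D_vars axiom_size pi_D pi_tree.
rewrite -/(proof_size pi) -(ler_nat R) natrX; apply: le_trans.
rewrite -powR_mulrn // ler_powR ?ler1n //.
have n_ge1 : 1 <= n%:R :> R by rewrite ler1n; lia.
have sqrt_le : Num.sqrt n%:R <= n%:R :> R.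
  rewrite -[leRHS]ger0_norm // -sqrtr_sqr ler_sqrt ?exprn_ge0 //.
  by rewrite expr2 ler_peMr.
rewrite mulrC ler_pdivrMr // (le_trans sqrt_le) // -natrM ler_nat; lia.
Qed.
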